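(* Let $I$ be a Lyubeznik ideal in $R=K[x_1,\ldots,x_n]$ with $G(I)=\{m_1\prec m_2\prec\cdots\prec m_\mu\}$, where $\prec$ is a total order such that the Lyubeznik resolution $\mathcal{L}_{\bullet(I,\prec)}$ is the minimal free resolution. Then, for all $t\ge1$ and all $j$, $$\beta_{t\,j}(R/I)=\beta_{t-1\,j}(I),$$ $$\beta_{t-1\,j}(I)=\bigl|\{u(i_1;i_2;\ldots;i_t): u(i_1;i_2;\ldots;i_t)\text{ is } L\text{-admissible},\ j=\deg(\mathrm{lcm}(m_{i_1},m_{i_2},\ldots,m_{i_t}))\}\bigr|,$$ $$\beta_{t-1\,j}(I)=\bigl|\{A=\{m_{i_1}\prec m_{i_2}\prec\cdots\prec m_{i_t}\}\subseteq G(I): A\text{ is preserved},\ j=\deg(\mathrm{lcm}(A))\}\bigr|.$$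
   Context: $K$ is a field, $I$ is a monomial ideal, and $G(I)$ is its minimal set of monomial generators. For a graded $R$-module $M$, $\beta_{i\,j}(M)=\dim_K \mathrm{Tor}_i^R(M,K)_j$ are the graded Betti numbers. For $A\subseteq G(I)$, $\mathrm{lcm}(A)$ is the least common multiple of its elements and $\min(A)$ its least element under $\prec$. A symbol is $u(i_1;\ldots;i_t)$ with $1\le i_1<\cdots<i_t\le\mu$; it is $L$-admissible (of dimension $t$) if for all $h<t$ and all $q<i_h$, $m_q$ does not divide $\mathrm{lcm}(m_{i_h},\ldots,m_{i_t})$. The Lyubeznik resolution $\mathcal{L}_{\bullet(I,\prec)}$ is the free resolution of $R/I$ with $L^0=R$, $L^t$ the free $R$-module on the $L$-admissible symbols of dimension $t$, and $$\partial_t(u(i_1;\ldots;i_t))=\sum_{j=1}^t(-1)^{j+1}\frac{\mathrm{lcm}(m_{i_1},\ldots,m_{i_t})}{\mathrm{lcm}(m_{i_1},\ldots,\widehat{m_{i_j}},\ldots,m_{i_t})}\,u(i_1;\ldots;\widehat{i_j};\ldots;i_t).$$ $I$ is a Lyubeznik ideal if for some total order on $G(I)$ the Lyubeznik resolution is a minimal free resolution of $R/I$. A (nonempty) subset $D\subseteq G(I)$ is broken if there is $u\in G(I)$ with $u\mid\mathrm{lcm}(D)$ and $u\prec\min(D)$. A subset $E\subseteq G(I)$ is preserved if no subset of $E$ is broken. *)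

(* Defs.v *)
From HB Require Import structures.
From mathcomp Require Import all_boot all_order all_algebra.
From mathcomp Require Import generic_quotient ring_quotient.
From mathcomp Require Import mpoly.
From mathcomp Require classical_sets.

Set Implicit Arguments.
Unset Strict Implicit.
Unset Printing Implicit Defensive.

Import GRing.Theory.
Local Open Scope ring_scope.
Local Open Scope quotient_scope.

Section SubQuotientModule.
Context (R : pzRingType) (V : lmodType R) (S : submodClosed V).

(* The submodule S and the quotient V / S, as R-modules. *)
Definition submod : Type := {x : V | x \in S}.

HB.instance Definition _ := SubChoice.on submod.
HB.instance Definition _ := [SubChoice_isSubLmodule of submod by <:].

Let S_zmod_closed : zmod_closed S.
Proof. exact: GRing.submod_closedB (submodClosedP S). Qed.

(* submodClosed does not inherit from zmodClosed, which quot requires. *)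
Definition submod_pred : {pred V} := S.
HB.instance Definition _ := GRing.isZmodClosed.Build V submod_pred S_zmod_closed.

Definition quotmod : Type := Quotient.quot submod_pred.

HB.instance Definition _ := GRing.Zmodule.on quotmod.

Definition quot_proj : V -> quotmod := \pi_(Quotient.quot submod_pred).

Definition quot_scale (a : R) (x : quotmod) : quotmod :=
  quot_proj (a *: repr (x : Quotient.quot submod_pred)).

Lemma quot_projP x y : quot_proj x = quot_proj y <-> x - y \in S.
Proof.
rewrite -[x - y \in S]/(x - y \in submod_pred) Quotient.idealrBE.
by split=> [/eqP|/eqP].
Qed.

Lemma quot_proj_surj (x : quotmod) : exists v, quot_proj v = x.
Proof. by exists (repr (x : Quotient.quot submod_pred)); exact: reprK. Qed.

Lemma quot_projD : {morph quot_proj : x y / x + y}.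
Proof. by move=> x y; rewrite /quot_proj [LHS]Quotient.pi_add. Qed.

Lemma quot_projZ a v : quot_proj (a *: v) = quot_scale a (quot_proj v).
Proof.
apply/quot_projP; rewrite -scalerBr rpredZ //; apply/quot_projP.
by rewrite /quot_proj reprK.
Qed.

Fact quot_scaleA a b x : quot_scale a (quot_scale b x) = quot_scale (a * b) x.
Proof.
by have [v <-] := quot_proj_surj x; rewrite -!quot_projZ scalerA.
Qed.

Fact quot_scale1 : left_id 1 quot_scale.
Proof. by move=> x; have [v <-] := quot_proj_surj x; rewrite -quot_projZ scale1r. Qed.

Fact quot_scaleDr : right_distributive quot_scale +%R.
Proof.
move=> a x y; have [v <-] := quot_proj_surj x; have [w <-] := quot_proj_surj y.
by rewrite -quot_projD -!quot_projZ scalerDr quot_projD.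
Qed.

Fact quot_scaleDl x : {morph quot_scale^~ x : a b / a + b}.
Proof.
move=> a b; have [v <-] := quot_proj_surj x.
by rewrite -!quot_projZ scalerDl quot_projD.
Qed.

HB.instance Definition _ := GRing.Zmodule_isLmodule.Build R quotmod
  quot_scaleA quot_scale1 quot_scaleDr quot_scaleDl.

Fact quot_proj_linear : linear quot_proj.
Proof. by move=> a x y; rewrite quot_projD quot_projZ. Qed.

HB.instance Definition _ :=
  GRing.isLinear.Build R V quotmod *:%R quot_proj quot_proj_linear.

End SubQuotientModule.

Section GradedBettiNumbers.
Context (K : fieldType) (n : nat).
Local Notation R := {mpoly K[n]}.

(* p is homogeneous of degree d in Z; for d < 0 this forces p = 0. *)
Definition homogz (d : int) (p : R) : bool :=
  all (fun u => (mdeg u)%:Z == d) (msupp p).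

(* F_0 <- F_1 <- F_2 <- ... with F_i free of rank [rk i] on a basis whose a-th
   element has degree [gdeg a]. Elements of F_i are row vectors and [diff i]
   acts on the right, so its a-th row is the image of the a-th basis element
   of F_(i+1). Finite ranks suffice for finitely generated modules, as R is
   noetherian. *)
Record free_complex := FreeComplex {
  rk : nat -> nat;
  gdeg : forall i, 'I_(rk i) -> int;
  diff : forall i, 'M[R]_(rk i.+1, rk i)
}.

(* The grading of an R-module M is given by its homogeneous elements:
   [grading d x] means that x belongs to the component M_d. *)
Definition graded_free_resolution (F : free_complex)
    (M : lmodType R) (grading : int -> M -> Prop) : Prop :=
  exists eps : {linear 'rV[R]_(rk F 0) -> M},
  [/\ forall a, grading (gdeg a) (eps (delta_mx 0 a)),
      forall i (a : 'I_(rk F i.+1)) (b : 'I_(rk F i)),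
        homogz (gdeg a - gdeg b) (diff F i a b),
      forall x, exists v, eps v = x,
      forall v, eps v = 0 <-> exists w, v = w *m diff F 0 &
      forall i (v : 'rV[R]_(rk F i.+1)),
        v *m diff F i = 0 <-> exists w, v = w *m diff F i.+1].

(* The image of each differential lies in (x_1, ..., x_n) F_i. *)
Definition minimal_complex (F : free_complex) : Prop :=
  forall i a b, (diff F i a b)@_0%MM = 0.

Definition minimal_graded_free_resolution (F : free_complex)
    (M : lmodType R) (grading : int -> M -> Prop) : Prop :=
  graded_free_resolution F grading /\ minimal_complex F.

(* F (x)_R K: as K = R / (x_1, ..., x_n), F_i (x) K is K^(rk i), on a basis of
   the same degrees, and the entries of the differentials become their
   constant terms. *)
Definition diffK (F : free_complex) (i : nat) : 'M[K]_(rk F i.+1, rk F i) :=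
  map_mx (mcoeff 0%MM) (diff F i).

Definition cyclesK (F : free_complex) (i : nat) : 'M[K]_(rk F i) :=
  match i with
  | 0 => 1%:M
  | i'.+1 => kermx (diffK F i')
  end.

(* Its row space is the component of degree j of F_i (x) K. *)
Definition degreeK (F : free_complex) (i : nat) (j : int) : 'M[K]_(rk F i) :=
  diag_mx (\row_a (gdeg a == j)%:R).

(* dim_K H_i(F (x) K)_j; the second row space is contained in the first. *)
Definition tor_dim (F : free_complex) (i : nat) (j : int) : nat :=
  (\rank (cyclesK F i :&: degreeK F i j)%MS
     - \rank (diffK F i :&: degreeK F i j)%MS)%N.

(* dim_K Tor_i^R(M, K)_j, computed from an arbitrarily chosen graded free
   resolution of M. The default value 0 is returned only if M has none, hence
   never for a finitely generated graded module. *)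
Definition betti (M : lmodType R) (grading : int -> M -> Prop)
    (i : nat) (j : int) : nat :=
  classical_sets.xget 0%N (fun b : nat =>
    exists2 F : free_complex,
      graded_free_resolution F grading & b = tor_dim F i j).

(* The gradings of an ideal I and of R / I inherited from R. *)
Definition ideal_grading (I : submodClosed R^o) (d : int) (x : submod I) :
    Prop :=
  homogz d (val x).

Definition quot_grading (I : submodClosed R^o) (d : int) (x : quotmod I) :
    Prop :=
  exists2 p : R, homogz d p & x = quot_proj I p.

Definition monomial_generators (I : submodClosed R^o) (s : seq 'X_{1..n}) :
    Prop :=
  forall p : R, p \in I <->
    exists c : 'X_{1..n} -> R, p = \sum_(u <- s) c u * 'X_[u].

(* s enumerates G(I) without repetition. *)
Definition minimal_monomial_generators (I : submodClosed R^o)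
    (s : seq 'X_{1..n}) : Prop :=
  [/\ uniq s, monomial_generators I s &
      forall s' : seq 'X_{1..n}, {subset s' <= s} ->
        monomial_generators I s' -> {subset s <= s'}].

End GradedBettiNumbers.

Arguments ideal_grading {K n} I d x.
Arguments quot_grading {K n} I d x.

(* The total order on G(I) is the order of enumeration of the tuple m, and
   subsets of G(I) are represented by sets of indices. Divisibility of
   monomials is (_ <= _)%MM. *)
Section Lyubeznik.
Context (n mu : nat) (m : mu.-tuple 'X_{1..n}).

Definition lcm_seq (s : seq 'I_mu) : 'X_{1..n} :=
  \big[@mlcm n/0%MM]_(i <- s) tnth m i.

Definition lcm_set (A : {set 'I_mu}) : 'X_{1..n} :=
  \big[@mlcm n/0%MM]_(i in A) tnth m i.

(* The symbol u(i_1; ...; i_t) is the increasing tuple s of its indices. As h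
   counts from 0, [drop h s] is the list i_(h+1), ..., i_t. *)
Definition L_admissible (t : nat) (s : t.-tuple 'I_mu) : bool :=
  sorted (fun i k : 'I_mu => i < k)%N s &&
  [forall h : 'I_t, (h.+1 < t)%N ==>
    [forall q : 'I_mu, (q < tnth s h)%N ==>
      ~~ (tnth m q <= lcm_seq (drop h s))%MM]].

Definition L_symbol (t : nat) : finType := {s : t.-tuple 'I_mu | L_admissible s}.

Definition omit (h : nat) (s : seq 'I_mu) : seq 'I_mu :=
  take h s ++ drop h.+1 s.

(* L^t is free on the symbols of dimension t; L^0 = R is spanned by the empty
   symbol. The sign is (-1)^((h+1)+1). *)
Definition lyubeznik (K : fieldType) : free_complex K n :=
  FreeComplex
    (rk := fun t => #|L_symbol t|)
    (fun t (a : 'I_#|L_symbol t|) => (mdeg (lcm_seq (val (enum_val a))))%:Z)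
    (fun t => \matrix_(a < #|L_symbol t.+1|, b < #|L_symbol t|)
      let s : seq 'I_mu := val (enum_val a) in
      let s' : seq 'I_mu := val (enum_val b) in
      \sum_(h < t.+1 | omit h s == s')
        (-1) ^+ h *: 'X_[K, (lcm_seq s - lcm_seq s')%MM]).

Definition broken (D : {set 'I_mu}) : bool :=
  [exists d in D, [forall k in D, (d <= k)%N] &&
    [exists u : 'I_mu, (tnth m u <= lcm_set D)%MM && (u < d)%N]].

Definition preserved (E : {set 'I_mu}) : bool :=
  [forall D : {set 'I_mu}, (D \subset E) ==> ~~ broken D].

End Lyubeznik.

(* Main.v *)
Require Import Defs.
From HB Require Import structures.
From mathcomp Require Import all_boot all_order all_algebra.
From mathcomp Require Import mpoly zify.
From mathcomp Require boolp classical_sets.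

Set Implicit Arguments.
Unset Strict Implicit.
Unset Printing Implicit Defensive.

(** A minimal resolution has zero differentials after tensoring with K, so the
    dimension of its homology in homological degree t and internal degree j
    is the number of basis elements of degree j in its t-th term. For the
    Lyubeznik resolution these basis elements are the admissible symbols of
    dimension t whose lcm has degree j, which gives the Betti numbers of R/I.
    Dropping the term L^0 = R turns a resolution of R/I into a resolution of I:
    the first differential sends u(i) to the generator m_i, so its image is I
    and its kernel is resolved by the remaining terms. Hence the shift between
    the Betti numbers of R/I and of I, read off from the same complex.

    Since the Betti numbers are defined through an arbitrary graded free
    resolution, the argument rests on the independence of Tor from the
    resolution ([betti_resolution]). It comes from the comparison theorem: the
    identity of M lifts to chain maps f : F -> G and g : G -> F, and fg is
    homotopic to the identity of F ([comparison], [homotopy_to_id]). After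
    tensoring with K, f therefore induces an injection in homology. It respects
    internal degrees because f can be chosen homogeneous: replacing each entry
    of a lift by its component of the expected degree ([hcomp_mx]) does not
    disturb the commutation with homogeneous differentials. This gives one
    inequality between the dimensions, and exchanging F and G gives the other
    ([tor_dim_le]).

    Finally, the set of indices of a symbol is preserved exactly when the symbol
    is admissible ([admissible_preserved]). Among the subsets with a given
    minimum i_h, the tail i_h, ..., i_t has the largest lcm, so only the tails
    need to be tested for being broken. The last tail consists of one generator,
    and is never broken because no minimal generator divides another one. *)

Import GRing.Theory.
Local Open Scope ring_scope.

(** * Homogeneous components of polynomials and matrices *)

Section HomogeneousComponents.
Context (K : fieldType) (n : nat).
Local Notation R := {mpoly K[n]}.

Definition hcomp (d : int) (p : R) : R :=
  \sum_(u <- msupp p | (mdeg u)%:Z == d) p@_u *: 'X_[u].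

Lemma mcoeff_hcomp d p u :
  (hcomp d p)@_u = if (mdeg u)%:Z == d then p@_u else 0.
Proof.
rewrite /hcomp raddf_sum /=.
under eq_bigr => v _ do rewrite mcoeffZ mcoeffX.
have [u_p|u_p] := boolP (u \in msupp p); last first.
  rewrite (memN_msupp_eq0 u_p) if_same big_seq_cond big1 // => v /andP[v_p _].
  by case: eqP u_p => [<-|]; rewrite ?v_p ?mulr0.
rewrite big_mkcond (bigD1_seq u) //= eqxx mulr1 big1 ?addr0 // => v /negPf uv.
by rewrite uv mulr0 if_same.
Qed.

Fact hcomp_is_linear d : linear (hcomp d).
Proof.
move=> c p q; apply/mpolyP => u.
by rewrite !(mcoeff_hcomp, mcoeffD, mcoeffZ); case: ifP; rewrite ?mulr0 ?addr0.
Qed.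
HB.instance Definition _ d := GRing.isLinear.Build K R R _ (hcomp d)
  (hcomp_is_linear d).

Lemma hcomp_homogz d p : homogz d p <-> hcomp d p = p.
Proof.
split=> [/allP hp|<-].
  apply/mpolyP => u; rewrite mcoeff_hcomp.
  case: ifP => // /negP nd; rewrite memN_msupp_eq0 //.
  by apply/negP => /hp.
by apply/allP => u; rewrite mcoeff_msupp mcoeff_hcomp; case: ifP; rewrite ?eqxx.
Qed.

Lemma hcompK d p : hcomp d (hcomp d p) = hcomp d p.
Proof. by apply/mpolyP => u; rewrite !mcoeff_hcomp; case: eqP. Qed.

Lemma hcompX d u : hcomp d 'X_[u] = if (mdeg u)%:Z == d then 'X_[u] else 0.
Proof.
apply/mpolyP => v; rewrite mcoeff_hcomp mcoeffX; case: (u =P v) => [->|uv].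
  by case: ifP => _; rewrite ?mcoeffX ?eqxx ?mcoeff0.
by rewrite if_same; case: ifP => _; rewrite ?mcoeffX ?mcoeff0 //; case: eqP uv.
Qed.

(** The factor [q] being homogeneous of degree [e], the part of degree [d] of a
    product [p * q] only sees the part of degree [d - e] of [p]. *)
Lemma hcompM d e p q : hcomp e q = q -> hcomp d (p * q) = hcomp (d - e) p * q.
Proof.
move=> hq; rewrite [p]mpolyE mulr_suml !linear_sum mulr_suml /=.
apply: eq_bigr => u _; rewrite -scalerAl !linearZ /= -scalerAl; congr (_ *: _).
have -> : q = \sum_(v <- msupp q | (mdeg v)%:Z == e) q@_v *: 'X_[v].
  by rewrite -{1}hq.
rewrite !mulr_sumr linear_sum /=.
apply: eq_bigr => v /eqP deg_v; rewrite -!scalerAr linearZ /=; congr (_ *: _).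
rewrite -mpolyXD hcompX hcompX mdegD -deg_v.
rewrite PoszD eq_sym -subr_eq eq_sym.
by case: ifP; rewrite ?mul0r ?mpolyXD.
Qed.

(** The degree-preserving part of the map of graded free modules given by [A],
    for bases of degrees [da] and [db]. The map is homogeneous exactly when [A]
    is a fixed point, which is how homogeneity is expressed below. *)
Definition hcomp_mx p q (da : 'I_p -> int) (db : 'I_q -> int)
    (A : 'M[R]_(p, q)) :=
  \matrix_(a, b) hcomp (da a - db b) (A a b).

Lemma hcomp_mxK p q (da : 'I_p -> int) (db : 'I_q -> int) (A : 'M_(p, q)) :
  hcomp_mx da db (hcomp_mx da db A) = hcomp_mx da db A.
Proof. by apply/matrixP => a b; rewrite !mxE hcompK. Qed.

(** This is why homogeneous lifts exist: from any solution [A] of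
    [A *m B = C], with [B] and [C] homogeneous, one gets a homogeneous one. *)
Lemma hcomp_mxM p q r (da : 'I_p -> int) (db : 'I_q -> int) (dc : 'I_r -> int)
    (A : 'M_(p, q)) (B : 'M_(q, r)) :
  hcomp_mx db dc B = B -> hcomp_mx da dc (A *m B) = hcomp_mx da db A *m B.
Proof.
move=> hB; apply/matrixP => a c; rewrite !mxE linear_sum /=.
apply: eq_bigr => b _; rewrite mxE (@hcompM _ (db b - dc c)).
  by congr (hcomp _ _ * _); lia.
by move/matrixP/(_ b c): hB; rewrite mxE.
Qed.

End HomogeneousComponents.

(** * Comparison of graded free resolutions *)

Section Comparison.
Context (K : fieldType) (n : nat).
Local Notation R := {mpoly K[n]}.

(** What the comparison theorem needs to know about a grading: there are
    component maps, compatible with the action of R. An existential statement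
    avoids choosing a normal form for homogeneous elements of a quotient. *)
Definition has_components (M : lmodType R) (grading : int -> M -> Prop) :=
  exists pr : int -> M -> M,
  [/\ forall d, {morph pr d : x y / x + y},
      forall d x, grading d x -> pr d x = x &
      forall d e p x, grading e x -> pr d (p *: x) = hcomp (d - e) p *: x].

(** [graded_free_resolution] with its augmentation made explicit, as lifts of
    the identity are lifts along the augmentations. *)
Definition resolution_via (F : free_complex K n) (M : lmodType R)
    (grading : int -> M -> Prop) (eps : {linear 'rV[R]_(rk F 0) -> M}) : Prop :=
  [/\ forall a, grading (gdeg a) (eps (delta_mx 0 a)),
      forall i (a : 'I_(rk F i.+1)) (b : 'I_(rk F i)),
        homogz (gdeg a - gdeg b) (diff F i a b),
      forall x, exists v, eps v = x,
      forall v, eps v = 0 <-> exists w, v = w *m diff F 0 &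
      forall i (v : 'rV[R]_(rk F i.+1)),
        v *m diff F i = 0 <-> exists w, v = w *m diff F i.+1].

Lemma row_factor p q r (X : 'M[R]_(p, r)) (Y : 'M[R]_(q, r)) :
  (forall a, exists w, row a X = w *m Y) -> exists Z, X = Z *m Y.
Proof.
move/fin_all_exists => [w Xw]; exists (\matrix_a w a).
by apply/row_matrixP => a; rewrite row_mul rowK.
Qed.

Section OneResolution.
Context (F : free_complex K n) (M : lmodType R) (grading : int -> M -> Prop).
Context (eps : {linear 'rV[R]_(rk F 0) -> M}).
Hypothesis resF : resolution_via grading eps.

Lemma diff_hcomp i :
  hcomp_mx (@gdeg _ _ F i.+1) (@gdeg _ _ F i) (diff F i) = diff F i.
Proof.
have [_ homF _ _ _] := resF.
by apply/matrixP => a b; rewrite mxE; apply/hcomp_homogz.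
Qed.

Lemma eps_diff v : eps (v *m diff F 0) = 0.
Proof. by have [_ _ _ ex0 _] := resF; apply/ex0; exists v. Qed.

Lemma diff_diff i : diff F i.+1 *m diff F i = 0.
Proof.
have [_ _ _ _ ex] := resF; apply/row_matrixP => a.
by rewrite row_mul row0; apply/ex; exists (delta_mx 0 a); rewrite rowE.
Qed.

Lemma exact0_mx p (X : 'M[R]_(p, rk F 0)) :
  (forall v, eps (v *m X) = 0) -> exists Y, X = Y *m diff F 0.
Proof.
have [_ _ _ ex0 _] := resF => X0; apply: row_factor => a.
by apply/ex0; rewrite rowE.
Qed.

Lemma exactS_mx p i (X : 'M[R]_(p, rk F i.+1)) :
  X *m diff F i = 0 -> exists Y, X = Y *m diff F i.+1.
Proof.
have [_ _ _ _ ex] := resF => X0; apply: row_factor => a.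
by apply/ex; rewrite -row_mul X0 row0.
Qed.

(** Constructed degree by degree from exactness. The induction only remembers
    that [phi i - 1 - h *m diff F i] is killed by the next differential, so the
    sequence of homotopies need not be built as a whole. *)
Lemma homotopy_to_id (phi : forall i, 'M[R]_(rk F i)) :
  (forall v, eps (v *m phi 0) = eps v) ->
  (forall i, diff F i *m phi i = phi i.+1 *m diff F i) ->
  (exists h, phi 0 - 1%:M = h *m diff F 0) /\
  (forall i, exists h h', phi i.+1 - 1%:M = h *m diff F i.+1 + diff F i *m h').
Proof.
move=> phi0 phiS.
have [h0 eq_h0]: exists h, phi 0 - 1%:M = h *m diff F 0.
  by apply: exact0_mx => v; rewrite mulmxBr raddfB /= phi0 mulmx1 subrr.
split; first by exists h0.
have next i h : diff F i *m (phi i - 1%:M - h *m diff F i) = 0 ->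
    exists h', phi i.+1 - 1%:M - diff F i *m h = h' *m diff F i.+1.
  move=> hi; apply: exactS_mx; rewrite -hi !mulmxBr !mulmxBl phiS mul1mx mulmx1.
  by rewrite mulmxA.
have homotopic i : exists h, diff F i *m (phi i - 1%:M - h *m diff F i) = 0.
  elim: i => [|i [h /next[h' eq_h']]].
    by exists h0; rewrite eq_h0 subrr mulmx0.
  exists h'; rewrite -eq_h' opprB addrCA subrr addr0 mulmxA diff_diff.
  by rewrite mul0mx.
move=> i; have [h /next[h' eq_h']] := homotopic i; exists h', h.
by rewrite -eq_h' subrK.
Qed.

End OneResolution.

(** The type of the [i]-th term depends on [i], as for the components of a chain
    map. *)
Lemma dependent_choice (T : nat -> Type) (S : forall i, T i -> Prop)
    (rel : forall i, T i -> T i.+1 -> Prop) (x0 : T 0) :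
  S 0 x0 -> (forall i x, S i x -> exists2 y, S i.+1 y & rel i x y) ->
  exists f : forall i, T i,
    [/\ f 0 = x0, forall i, S i (f i) & forall i, rel i (f i) (f i.+1)].
Proof.
move=> S0 step.
have next i (x : {x | S i x}) : {y : {y | S i.+1 y} | rel i (sval x) (sval y)}.
  have /boolp.cid2[y Sy xy] := step i _ (svalP x).
  by exists (exist _ y Sy).
pose f := nat_rect _ (exist _ x0 S0) (fun i x => sval (next i x)).
exists (fun i => sval (f i)); split=> // i; first exact: svalP.
exact: svalP (next i (f i)).
Qed.

Section TwoResolutions.
Context (M : lmodType R) (grading : int -> M -> Prop).
Hypothesis gradedM : has_components grading.
Context (F G : free_complex K n).
Context (epsF : {linear 'rV[R]_(rk F 0) -> M}).
Context (epsG : {linear 'rV[R]_(rk G 0) -> M}).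
Hypothesis resF : resolution_via grading epsF.
Hypothesis resG : resolution_via grading epsG.

(** Lift the images of the basis of F_0, then keep the components of the right
    degrees: since these images are homogeneous, the discarded components of
    the lifts are sent to zero in total. *)
Lemma lift_augmentation : exists f : 'M[R]_(rk F 0, rk G 0),
  hcomp_mx (@gdeg _ _ F 0) (@gdeg _ _ G 0) f = f /\
  forall v, epsG (v *m f) = epsF v.
Proof.
have [pr [prD pr_id prZ]] := gradedM.
have pr_sum d k (x : 'I_k -> M) : pr d (\sum_b x b) = \sum_b pr d (x b).
  apply: (big_morph _ (prD d)).
  by apply: (addrI (pr d 0)); rewrite -prD !addr0.
have [homF _ _ _ _] := resF; have [homG _ surjG _ _] := resG.
have /fin_all_exists[w eq_w] a : exists w, epsG w = epsF (delta_mx 0 a).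
  exact: surjG.
have eps_sum (H : free_complex K n) (e : {linear 'rV[R]_(rk H 0) -> M}) v :
    e v = \sum_b v 0 b *: e (delta_mx 0 b).
  rewrite {1}[v]row_sum_delta linear_sum; apply: eq_bigr => b _.
  by rewrite linearZ.
pose f := hcomp_mx (@gdeg _ _ F 0) (@gdeg _ _ G 0) (\matrix_a w a).
exists f; split=> [|v]; first exact: hcomp_mxK.
have eps_row a : epsG (row a f) = epsF (delta_mx 0 a).
  rewrite -(pr_id _ _ (homF a)) -eq_w [epsG (w a)]eps_sum eps_sum pr_sum.
  by apply: eq_bigr => b _; rewrite (prZ _ _ _ _ (homG b)) !mxE.
rewrite (eps_sum _ epsF) mulmx_sum_row linear_sum; apply: eq_bigr => a _.
by rewrite linearZ /= eps_row.
Qed.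

(** Here the chain map is wanted as a sequence, because it is composed with a
    chain map in the other direction before [homotopy_to_id] applies. *)
Lemma comparison : exists f : forall i, 'M[R]_(rk F i, rk G i),
  [/\ forall v, epsG (v *m f 0) = epsF v,
      forall i, hcomp_mx (@gdeg _ _ F i) (@gdeg _ _ G i) (f i) = f i &
      forall i, diff F i *m f i = f i.+1 *m diff G i].
Proof.
have [f0 [hom0 eps0]] := lift_augmentation.
pose liftable i (x : 'M[R]_(rk F i, rk G i)) :=
  hcomp_mx (@gdeg _ _ F i) (@gdeg _ _ G i) x = x /\
  exists y, diff F i *m x = y *m diff G i.
have [||f [f_0 f_S f_comm]] := @dependent_choice _ liftable
    (fun i x y => diff F i *m x = y *m diff G i) f0.
- split=> //; apply: (exact0_mx resG) => v.
  by rewrite mulmxA eps0 (eps_diff resF).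
- move=> i x [homx [y eq_y]].
  pose y' := hcomp_mx (@gdeg _ _ F i.+1) (@gdeg _ _ G i.+1) y.
  have eq_y' : diff F i *m x = y' *m diff G i.
    rewrite -(hcomp_mxM _ _ (diff_hcomp resG i)) -eq_y (hcomp_mxM _ _ homx).
    by rewrite (diff_hcomp resF).
  exists y' => //; split; first exact: hcomp_mxK.
  apply: (exactS_mx resG).
  by rewrite -mulmxA -eq_y' mulmxA (diff_diff resF) mul0mx.
by exists f; split=> // [v|i]; rewrite ?f_0 //; have [] := f_S i.
Qed.

End TwoResolutions.
End Comparison.

(** * Graded Betti numbers do not depend on the resolution *)

Section TorDimension.
Context (K : fieldType) (n : nat).
Local Notation R := {mpoly K[n]}.

(** The last hypothesis makes the map induced by [f] from A / (A cap B) to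
    A' / B' injective. *)
Lemma mxrank_subquotient_le m1 m2 m3 m4 p q (A : 'M[K]_(m1, p))
    (B : 'M[K]_(m2, p)) (A' : 'M[K]_(m3, q)) (B' : 'M[K]_(m4, q))
    (f : 'M[K]_(p, q)) :
  (A *m f <= A')%MS -> (B' <= A')%MS ->
  (forall z : 'rV_p, z <= A -> z *m f <= B' -> z <= B)%MS ->
  (\rank A - \rank B <= \rank A' - \rank B')%N.
Proof.
move=> fA sB'A' reflB; pose c := cokermx B'.
have rkA := mxrank_mul_ker A (f *m c); have rkA' := mxrank_mul_ker A' c.
have leB : (\rank (A :&: kermx (f *m c))%MS <= \rank B)%N.
  apply/mxrankS/row_subP => i; apply: reflB.
    exact: submx_trans (row_sub _ _) (capmxSl _ _).
  have /sub_kermxP : (row i (A :&: kermx (f *m c)) <= kermx (f *m c))%MS.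
    exact: submx_trans (row_sub _ _) (capmxSr _ _).
  by rewrite mulmxA => zfc; rewrite submxE -/c zfc.
have geB' : (\rank B' <= \rank (A' :&: kermx c)%MS)%N.
  by apply/mxrankS; rewrite sub_capmx sB'A' sub_kermx mulmx_coker eqxx.
have leA : (\rank (A *m (f *m c)) <= \rank (A' *m c))%N.
  by apply/mxrankS; rewrite mulmxA submxMr.
lia.
Qed.

Local Notation red := (map_mx (mcoeff 0%MM)).

(** A constant entry of a homogeneous matrix links basis elements of the same
    degree. *)
Lemma degreeK_red (F G : free_complex K n) i j (f : 'M[R]_(rk F i, rk G i)) :
  hcomp_mx (@gdeg _ _ F i) (@gdeg _ _ G i) f = f ->
  degreeK F i j *m red f = red f *m degreeK G i j.
Proof.
move=> homf; apply/matrixP => a b.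
rewrite mul_diag_mx mul_mx_diag !mxE [RHS]mulrC.
have [->|nz_fab] := eqVneq ((f a b)@_0%MM) 0; first by rewrite !mulr0.
rewrite -homf mxE mcoeff_hcomp mdeg0 in nz_fab *.
case: ifP nz_fab => [|_]; last by rewrite eqxx.
by rewrite eq_sym subr_eq0 => /eqP->.
Qed.

(** The chain map F -> G is injective in homology, being invertible on the left
    up to homotopy; as it is homogeneous it restricts to the degree [j]
    strands. The inverse G -> F up to homotopy serves to reflect boundaries. *)
Lemma tor_dim_le (F G : free_complex K n) (M : lmodType R)
    (grading : int -> M -> Prop) i j :
  has_components grading -> graded_free_resolution F grading ->
  graded_free_resolution G grading -> (tor_dim F i j <= tor_dim G i j)%N.
Proof.
move=> gradedM [epsF resF] [epsG resG].
have [f [epsf homf commf]] := comparison gradedM resF resG.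
have [g [epsg _ commg]] := comparison gradedM resG resF.
have [|k|] := @homotopy_to_id _ _ _ _ _ _ resF (fun k => f k *m g k).
- by move=> v; rewrite mulmxA epsg epsf.
- by rewrite mulmxA commf -!mulmxA commg.
move=> homot0 homotS.
have redM p q r (A : 'M[R]_(p, q)) (B : 'M[R]_(q, r)) :
  red (A *m B) = red A *m red B by exact: map_mxM.
have comp k : diffK G k.+1 *m diffK G k = 0.
  by rewrite -redM (diff_diff resG) map_mx0.
have boundary_cycle : (diffK G i <= cyclesK G i)%MS.
  case: i => [|k]; first exact: submx1.
  by rewrite /= sub_kermx comp.
have f_cycle : (cyclesK F i *m red (f i) <= cyclesK G i)%MS.
  case: i {boundary_cycle} => [|k]; first exact: submx1.
  by rewrite /= sub_kermx -mulmxA -redM -commf redM mulmxA mulmx_ker mul0mx.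
have f_boundary (z : 'rV_(rk F i)) :
    (z <= cyclesK F i -> z *m red (f i) <= diffK G i -> z <= diffK F i)%MS.
  move=> cycle_z /submxP[w eq_w].
  have: (z *m red (f i *m g i) <= diffK F i)%MS.
    by rewrite redM mulmxA eq_w -mulmxA -redM commg redM mulmxA submxMl.
  (* On cycles f g and the identity differ by a boundary, by homotopy. *)
  suff [y eq_y] : exists y, z *m red (f i *m g i - 1%:M) = y *m diffK F i.
    move: eq_y; rewrite map_mxB map_mx1 mulmxBr mulmx1 => eq_y zfg.
    rewrite -[z](subKr (z *m red (f i *m g i))) eq_y -mulNmx.
    by rewrite addmx_sub // submxMl.
  case: i z cycle_z {w eq_w boundary_cycle f_cycle} => [|k] z cycle_z.
    by have [h ->] := homot0; exists (z *m red h); rewrite redM mulmxA.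
  have [h [h' ->]] := homotS k; exists (z *m red h).
  rewrite map_mxD !redM mulmxDr [X in _ + X]mulmxA.
  by move: cycle_z => /sub_kermxP ->; rewrite mul0mx addr0 mulmxA.
apply: (@mxrank_subquotient_le _ _ _ _ _ _ _ _ _ _ (red (f i))).
- rewrite sub_capmx (submx_trans _ f_cycle) ?submxMr ?capmxSl //=.
  apply: submx_trans (submxMr _ (capmxSr _ _)) _.
  by rewrite (degreeK_red j (homf i)) submxMl.
- exact: capmxS boundary_cycle (submx_refl _).
move=> z; rewrite !sub_capmx => /andP[cz ->] /andP[bz _].
by rewrite f_boundary.
Qed.

Lemma betti_resolution (F : free_complex K n) (M : lmodType R)
    (grading : int -> M -> Prop) i j :
  has_components grading -> graded_free_resolution F grading ->
  betti grading i j = tor_dim F i j.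
Proof.
move=> gradedM resF; apply: classical_sets.xget_unique; first by exists F.
move=> b [G resG ->]; apply/eqP.
by rewrite eqn_leq !(@tor_dim_le _ _ M grading).
Qed.

(** A coordinate projection factors through the coordinates that it keeps. *)
Lemma rank_diag_indicator N (P : pred 'I_N) :
  \rank (diag_mx (\row_a (P a)%:R) : 'M[K]_N) = #|P|.
Proof.
pose E : 'M[K]_(#|P|, N) := rowsub (fun i => enum_val i) 1%:M.
have freeE : row_free E.
  apply/row_freeP; exists E^T; apply/matrixP => i k; rewrite !mxE.
  rewrite (bigD1 (enum_val i)) //= big1 => [|b /negPf nb].
    rewrite !mxE eqxx mul1r addr0 eq_sym (inj_eq enum_val_inj) eq_sym.
    by congr (_ _).
  by rewrite !mxE eq_sym nb mul0r.
have -> : diag_mx (\row_a (P a)%:R) = E^T *m E.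
  apply/matrixP => a b; rewrite !mxE.
  have [Pa|/negPf nPa] := boolP (P a).
    rewrite (bigD1 (enum_rank_in Pa a)) //= big1 => [|i ni].
      by rewrite !mxE !enum_rankK_in // eqxx mul1r addr0; case: (a == b).
    rewrite !mxE (_ : (enum_val i == a) = false) ?mul0r //.
    apply: contraNF ni => /eqP eq_a; apply/eqP/enum_val_inj.
    by rewrite eq_a enum_rankK_in.
  rewrite mul0rn big1 // => i _; rewrite !mxE.
  case: eqP => [eq_a|_]; last by rewrite mul0r.
  by have := enum_valP i; rewrite eq_a unfold_in nPa.
by rewrite mxrankMfree // mxrank_tr; apply/eqP.
Qed.

Lemma rank_degreeK (F : free_complex K n) i j :
  \rank (degreeK F i j) = #|[set a : 'I_(rk F i) | gdeg a == j]|.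
Proof.
by rewrite rank_diag_indicator cardsE.
Qed.

Lemma tor_dim_minimal (F : free_complex K n) i j :
  minimal_complex F -> tor_dim F i j = #|[set a : 'I_(rk F i) | gdeg a == j]|.
Proof.
move=> minF.
have diffK0 k : diffK F k = 0 by apply/matrixP => a b; rewrite !mxE minF.
rewrite -rank_degreeK /tor_dim diffK0 cap0mx mxrank0 subn0.
rewrite (capmx_idPr (submx_full _ _)) //.
case: i => [|i] /=; first by rewrite -sub1mx.
by rewrite diffK0 -sub1mx kermx0.
Qed.

End TorDimension.

(** * The gradings of I and of R / I *)

Section IdealGradings.
Context (K : fieldType) (n : nat) (I : submodClosed {mpoly K[n]}^o).
Context (s : seq 'X_{1..n}).
Local Notation R := {mpoly K[n]}.

Lemma ideal_mul (p q : R) : q \in I -> p * q \in I.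
Proof. exact: (@rpredZ _ _ I p q). Qed.

Lemma mem_generator u : uniq s -> monomial_generators I s -> u \in s ->
  'X_[u] \in I.
Proof.
move=> uniq_s gen_s su; apply/gen_s; exists (fun v => (v == u)%:R).
rewrite (bigD1_seq u) //= eqxx mul1r big1 ?addr0 // => v /negPf ->.
by rewrite mul0r.
Qed.

(** The component of a combination of homogeneous generators is again such a
    combination. Both component maps below rest on this: on I by restriction,
    and on R / I by passing to the quotient. *)
Lemma hcomp_mem d p : monomial_generators I s -> p \in I -> hcomp d p \in I.
Proof.
move=> gen_s /gen_s[c ->]; apply/gen_s.
exists (fun u => hcomp (d - (mdeg u)%:Z) (c u)); rewrite linear_sum /=.
by apply: eq_bigr => u _; rewrite (@hcompM _ _ _ (mdeg u)) // hcompX eqxx.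
Qed.

Lemma ideal_has_components :
  monomial_generators I s -> has_components (ideal_grading I).
Proof.
move=> gen_s.
exists (fun d (x : submod I) => exist _ (hcomp d (val x))
  (hcomp_mem d gen_s (valP x)) : submod I).
split=> [d x y|d x homx|d e p x homx]; apply: val_inj => /=.
- by rewrite linearD.
- exact/hcomp_homogz.
- by rewrite -[RHS]/(_ * val x) -hcompM //; apply/hcomp_homogz.
Qed.

Lemma quot_has_components :
  monomial_generators I s -> has_components (quot_grading I).
Proof.
move=> gen_s; have [r rK] := boolp.choice (@quot_proj_surj _ _ I).
pose pr d x := quot_proj I (hcomp d (r x)).
have prE d p : pr d (quot_proj I p) = quot_proj I (hcomp d p).
  apply/quot_projP; rewrite -linearB; apply: hcomp_mem gen_s _.
  by apply/quot_projP.
exists pr; split=> [d x y|d x [p homp ->]|d e p x [q homq ->]].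
- by rewrite -{1}[x]rK -{1}[y]rK -quot_projD prE linearD quot_projD.
- by rewrite prE; congr quot_proj; apply/hcomp_homogz.
rewrite -!linearZ /= prE; congr quot_proj.
by apply: hcompM; apply/hcomp_homogz.
Qed.

End IdealGradings.

(** If [u] divides another generator [v], then [v] is redundant: its
    coefficient can be moved to [u]. *)
Lemma minimal_generators_antichain (K : fieldType) n
    (I : submodClosed {mpoly K[n]}^o) (s : seq 'X_{1..n}) u v :
  minimal_monomial_generators I s -> u \in s -> v \in s -> (u <= v)%MM -> u = v.
Proof.
move=> [uniq_s gen_s min_s] su sv le_uv; apply/eqP/negPn/negP => neq_uv.
have /min_s : {subset [seq w <- s | w != v] <= s}.
  by move=> w; rewrite mem_filter => /andP[].
suff gen_sv : monomial_generators I [seq w <- s | w != v].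
  by move=> /(_ gen_sv v sv); rewrite mem_filter eqxx.
move=> p; split=> [/gen_s[c ->]|[c ->]]; last first.
  rewrite big_seq; apply: (@rpred_sum _ I) => w.
  rewrite mem_filter => /andP[_ sw]; exact/ideal_mul/(mem_generator _ gen_s).
exists (fun w => c w + (w == u)%:R * (c v * 'X_[v - u])).
under [RHS]eq_bigr do rewrite mulrDl.
rewrite big_split /= !big_filter (bigD1_seq v) //= addrC; congr (_ + _).
rewrite -big_filter (bigD1_seq u) ?filter_uniq ?mem_filter ?neq_uv //=.
rewrite eqxx mul1r big1 => [|w /negPf->]; last by rewrite !mul0r.
by rewrite addr0 -mulrA -mpolyXD submK.
Qed.

(** * Admissible symbols and preserved sets *)

Section LyubeznikCombinatorics.
Context (n mu : nat) (m : mu.-tuple 'X_{1..n}).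
Hypothesis antichain : forall i k, (tnth m i <= tnth m k)%MM -> i = k.
Local Notation ltI := (fun i k : 'I_mu => i < k)%N.

Lemma ltI_trans : transitive ltI.
Proof. by move=> i k l; apply: ltn_trans. Qed.

(** The universal property of the lcm, from which the comparisons of lcms below
    follow; it also makes the order of the factors immaterial. *)
Lemma lcm_seq_lem (s : seq 'I_mu) w :
  (lcm_seq m s <= w)%MM = all (fun i => (tnth m i <= w)%MM) s.
Proof.
rewrite /lcm_seq; elim: s => [|i s IHs]; first last.
  by rewrite big_cons lem_mlcm IHs.
by rewrite big_nil; apply/mnm_lepP => i; rewrite mnm0E.
Qed.

Lemma lem_lcm_seq (s : seq 'I_mu) i : i \in s -> (tnth m i <= lcm_seq m s)%MM.
Proof.
by move: i; apply/allP; rewrite -lcm_seq_lem lepm_refl.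
Qed.

Lemma eq_lcm_seq (s1 s2 : seq 'I_mu) :
  s1 =i s2 -> lcm_seq m s1 = lcm_seq m s2.
Proof.
have le (r1 r2 : seq 'I_mu) :
    {subset r1 <= r2} -> (lcm_seq m r1 <= lcm_seq m r2)%MM.
  by move=> sub; rewrite lcm_seq_lem; apply/allP => i /sub/lem_lcm_seq.
move=> eq_s; apply/mnmP => x; apply/eqP; rewrite eqn_leq.
by apply/andP; split; apply/mnm_lepP/le => i; rewrite eq_s.
Qed.

Lemma lcm_setE (A : {set 'I_mu}) : lcm_set m A = lcm_seq m (enum A).
Proof.
rewrite /lcm_set; have [e <- [_ mem_e] _] := big_enumP (mem A).
by apply: eq_lcm_seq => i; rewrite mem_e mem_enum.
Qed.

Lemma sorted_enum (A : {set 'I_mu}) : sorted ltI (enum A).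
Proof.
rewrite /enum_mem -enumT; apply: sorted_filter; first exact: ltI_trans.
by rewrite -(sorted_map (f := val) (e' := ltn)) val_enum_ord iota_ltn_sorted.
Qed.

Lemma enum_sorted (s : seq 'I_mu) : sorted ltI s -> enum [set i in s] = s.
Proof.
move=> sorted_s; apply: (irr_sorted_eq ltI_trans) => //.
- by move=> i; apply: ltnn.
- exact: sorted_enum.
by move=> i; rewrite mem_enum inE.
Qed.

(** A broken subset D with minimum i_h is contained in the tail i_h, ..., i_t,
    which is then broken too; conversely an inadmissible symbol has a broken
    tail. Admissibility says nothing about the tail i_t alone, and there the
    antichain property is what excludes a smaller divisor. *)
Lemma admissible_preserved t (s : t.-tuple 'I_mu) :
  sorted ltI s -> L_admissible m s = preserved m [set i in s].
Proof.
move=> sorted_s; rewrite /L_admissible sorted_s /=.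
have pw_s : pairwise ltI s by rewrite -(sorted_pairwise ltI_trans).
apply/forallP/forallP => [adm D|pres h]; apply/implyP.
  move=> /subsetP sDs; apply/negP => /exists_inP[d Dd /andP[/forall_inP min_d]].
  move=> /existsP[u /andP[le_u lt_ud]].
  have sd : d \in val s by have := sDs _ Dd; rewrite inE.
  have lt_h : (index d s < t)%N.
    by rewrite -[X in (_ < X)%N](size_tuple s) index_mem.
  have drop_h : drop (index d s) s = d :: drop (index d s).+1 s.
    by rewrite (drop_nth d) ?index_mem // nth_index.
  have {}le_u : (tnth m u <= lcm_seq m (drop (index d s) s))%MM.
    apply: lepm_trans le_u _; rewrite lcm_setE lcm_seq_lem.
    apply/allP => k; rewrite mem_enum => Dk; apply: lem_lcm_seq.
    have : k \in take (index d s) s ++ drop (index d s) s.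
      by rewrite cat_take_drop; have := sDs _ Dk; rewrite inE.
    rewrite mem_cat => /orP[take_k|//].
    move: pw_s; rewrite -[X in pairwise _ X](cat_take_drop (index d s)) drop_h.
    rewrite pairwise_cat => /andP[/allrelP/(_ k d take_k (mem_head _ _))].
    by rewrite ltnNge min_d.
  have [lt_h1|le_th] := ltnP (index d s).+1 t.
    have /implyP/(_ lt_h1)/forallP/(_ u)/implyP := adm (Ordinal lt_h).
    by rewrite (tnth_nth d) nth_index // => /(_ lt_ud)/negP[].
  move: le_u; rewrite drop_h drop_oversize ?size_tuple //.
  rewrite /lcm_seq big_cons big_nil mlcm0 => /antichain eq_ud.
  by rewrite eq_ud ltnn in lt_ud.
move=> lt_h1; apply/forallP => q; apply/implyP => lt_q; apply/negP => le_q.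
have drop_h : drop h s = tnth s h :: drop h.+1 s.
  by rewrite (drop_nth (tnth s h)) ?size_tuple // -tnth_nth.
have sorted_h : sorted ltI (drop h s) by apply: drop_sorted.
have /implyP/(_ _)/negP[] := pres [set i in drop h s].
  by apply/subsetP => i; rewrite !inE => /mem_drop.
apply/exists_inP; exists (tnth s h); first by rewrite inE drop_h mem_head.
apply/andP; split; last first.
  by apply/existsP; exists q; rewrite lt_q andbT lcm_setE enum_sorted.
apply/forall_inP => k; rewrite inE drop_h inE => /orP[/eqP->//|drop_k].
move: sorted_h; rewrite (sorted_pairwise ltI_trans) drop_h /= => /andP[].
by move=> /allP/(_ k drop_k)/ltnW.
Qed.

Lemma card_admissible_preserved t (j : int) :
  #|[set s : t.-tuple 'I_mu |
      L_admissible m s && ((mdeg (lcm_seq m s))%:Z == j)]| =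
  #|[set A : {set 'I_mu} |
      [&& #|A| == t, preserved m A & (mdeg (lcm_set m A))%:Z == j]]|.
Proof.
rewrite -(card_in_imset (f := fun s : t.-tuple _ => [set i in s])); last first.
  move=> s1 s2; rewrite !inE => /andP[/andP[sort1 _] _] /andP[/andP[sort2 _] _].
  move=> eq_set; apply/val_inj.
  by rewrite /= -(enum_sorted sort1) eq_set enum_sorted.
congr #|pred_of_set _|; apply/setP => A; rewrite inE; apply/imsetP/idP.
  move=> [s + ->]; rewrite inE => /andP[adm_s deg_s].
  have sort_s : sorted ltI s by have /andP[] := adm_s.
  rewrite -admissible_preserved // adm_s lcm_setE enum_sorted // deg_s.
  by rewrite cardE enum_sorted // size_tuple eqxx.
move=> /and3P[card_A pres_A deg_A].
have size_A : size (enum A) == t by rewrite -cardE.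
have set_A : [set i in Tuple size_A] = A.
  by apply/setP => i; rewrite inE /= mem_enum.
exists (Tuple size_A) => //; rewrite inE admissible_preserved ?sorted_enum //.
by rewrite set_A pres_A -lcm_setE.
Qed.

Lemma card_symbols (K : fieldType) t j :
  #|[set a : 'I_(rk (lyubeznik m K) t) | gdeg a == j]| =
  #|[set s : t.-tuple 'I_mu |
      L_admissible m s && ((mdeg (lcm_seq m s))%:Z == j)]|.
Proof.
rewrite -(card_imset _ (inj_comp val_inj enum_val_inj)).
congr #|pred_of_set _|; apply/setP => s; rewrite inE; apply/imsetP/andP.
  move=> [a + ->]; rewrite inE => deg_a; split=> //.
  exact: (valP (enum_val a)).
move=> [adm_s deg_s]; exists (enum_rank (Sub s adm_s : L_symbol m t)).
  by rewrite inE /gdeg /= enum_rankK.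
by rewrite /= enum_rankK.
Qed.

End LyubeznikCombinatorics.

(** * The truncated Lyubeznik complex resolves I *)

Section IdealResolution.
Context (K : fieldType) (n mu : nat) (I : submodClosed {mpoly K[n]}^o).
Context (m : mu.-tuple 'X_{1..n}).
Local Notation R := {mpoly K[n]}.
Local Notation F := (lyubeznik m K).

Definition tail_complex (G : free_complex K n) : free_complex K n :=
  FreeComplex (fun i => @gdeg _ _ G i.+1) (fun i => diff G i.+1).

Lemma singleton_admissible (i : 'I_mu) : L_admissible m [tuple i].
Proof. by apply/forallP => h; apply/implyP; case: h => [[]]. Qed.

Definition symbol1 (i : 'I_mu) : 'I_(rk F 1) :=
  enum_rank (Sub [tuple i] (singleton_admissible i) : L_symbol m 1).

Definition index1 (a : 'I_(rk F 1)) : 'I_mu := thead (val (enum_val a)).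

Lemma symbol1K : cancel symbol1 index1.
Proof. by move=> i; rewrite /index1 /symbol1 enum_rankK. Qed.

Lemma index1K : cancel index1 symbol1.
Proof.
have tuple1 (s : 1.-tuple 'I_mu) : [tuple thead s] = s.
  by case/tupleP: s => i s; apply: val_inj; rewrite theadE [s]tuple0.
move=> a; apply: enum_val_inj; apply: val_inj; rewrite enum_rankK.
exact: tuple1.
Qed.

Lemma empty_admissible : L_admissible m [tuple].
Proof. by apply/forallP => -[]. Qed.

Definition symbol0 : 'I_(rk F 0) :=
  enum_rank (Sub [tuple] empty_admissible : L_symbol m 0).

Lemma symbol0_unique b : b = symbol0.
Proof.
by apply: enum_val_inj; apply: val_inj; rewrite enum_rankK /= tuple0.
Qed.

Lemma diff_symbol1 a : diff F 0 a symbol0 = 'X_[tnth m (index1 a)].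
Proof.
rewrite -{1}(index1K a) mxE !enum_rankK /= big_mkcond big_ord1 /=.
rewrite expr0 scale1r /lcm_seq big_cons !big_nil mlcm0; congr 'X_[_].
by apply/mnmP => x; rewrite mnmBE mnm0E subn0.
Qed.

Hypothesis uniq_m : uniq m.
Hypothesis gen_m : monomial_generators I m.

Lemma mem_image_diff p :
  p \in I <-> exists v : 'rV_(rk F 1), p = (v *m diff F 0) 0 symbol0.
Proof.
have imageE (v : 'rV_(rk F 1)) : (v *m diff F 0) 0 symbol0 =
    \sum_(i < mu) v 0 (symbol1 i) * 'X_[tnth m i].
  rewrite mxE (reindex_onto symbol1 index1) => [|a _]; last exact: index1K.
  apply: eq_big => [i|i _]; first by rewrite symbol1K eqxx.
  by rewrite diff_symbol1 symbol1K.
split=> [/gen_m[c ->]|[v ->]].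
  exists (\row_a c (tnth m (index1 a))); rewrite imageE big_tuple.
  by apply: eq_bigr => i _; rewrite mxE symbol1K.
rewrite imageE; apply: (@rpred_sum _ I) => i _; apply: ideal_mul.
exact: mem_generator gen_m (mem_tnth _ _).
Qed.

(** The augmentation onto I is the first differential: [mem_image_diff]
    identifies its image, and the exactness of the given resolution at L^1 its
    kernel. *)
Lemma ideal_resolution : graded_free_resolution F (quot_grading I) ->
  graded_free_resolution (tail_complex F) (ideal_grading I).
Proof.
move=> [eps [_ homF _ _ exactF]].
pose image (v : 'rV[R]_(rk (tail_complex F) 0)) : submod I :=
  exist _ ((v *m diff F 0) 0 symbol0)
      ((mem_image_diff _).2 (ex_intro _ v erefl)).
have image_linear : linear image.
  by move=> c v w; apply: val_inj; rewrite /= mulmxDl -scalemxAl !mxE.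
pose image_lin : {linear 'rV[R]_(rk (tail_complex F) 0) -> submod I} :=
  HB.pack image (GRing.isLinear.Build _ _ _ _ image image_linear).
have imageE v : val (image_lin v) = (v *m diff F 0) 0 symbol0 by [].
exists image_lin; split=> [a|i a b|x|v|i v].
- rewrite /ideal_grading imageE -rowE mxE.
  have := homF 0 a symbol0; congr homogz.
  by rewrite {2}/gdeg /= enum_rankK /= /lcm_seq big_nil mdeg0 subr0.
- exact: homF.
- have [v eq_v] := (mem_image_diff (val x)).1 (valP x).
  by exists v; apply: val_inj; rewrite imageE -eq_v.
- rewrite -(exactF 0 v); split=> [/(congr1 val)|v0].
    rewrite imageE => v0; apply/matrixP => a b.
    by rewrite ord1 (symbol0_unique b) v0 mxE.
  by apply: val_inj; rewrite imageE v0 mxE.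
- exact: exactF.
Qed.

End IdealResolution.

Theorem theorem5p3 (K : fieldType) (n mu : nat)
  (I : submodClosed {mpoly K[n]}^o) (m : mu.-tuple 'X_{1..n})
  (hG : minimal_monomial_generators I m)
  (hL : minimal_graded_free_resolution (lyubeznik m K) (quot_grading I))
  (t : nat) (ht : (0 < t)%N) (j : int) :
  [/\ betti (quot_grading I) t j = betti (ideal_grading I) t.-1 j,
      betti (ideal_grading I) t.-1 j =
        #|[set s : t.-tuple 'I_mu |
            L_admissible m s && ((mdeg (lcm_seq m s))%:Z == j)]| &
      betti (ideal_grading I) t.-1 j =
        #|[set A : {set 'I_mu} |
            [&& #|A| == t, preserved m A & (mdeg (lcm_set m A))%:Z == j]]|].
Proof.
have [uniq_m gen_m _] := hG; have [resF minF] := hL.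
have antichain i k : (tnth m i <= tnth m k)%MM -> i = k.
  move/(minimal_generators_antichain hG (mem_tnth i m) (mem_tnth k m)).
  by move/tuple_uniqP: uniq_m; apply.
have betti_ideal : betti (ideal_grading I) t.-1 j =
    #|[set a : 'I_(rk (lyubeznik m K) t) | gdeg a == j]|.
  rewrite (betti_resolution _ _ (ideal_has_components gen_m)
    (ideal_resolution uniq_m gen_m resF)).
  rewrite tor_dim_minimal; last by move=> i; apply: minF.
  by case: t ht.
rewrite betti_ideal (betti_resolution _ _ (quot_has_components gen_m) resF).
rewrite tor_dim_minimal // card_symbols.
by split; rewrite // card_admissible_preserved.
Qed.
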